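(* For $0<p<1$, let $\mathbb{E}[Y]_\infty=\lim_{N\to\infty}\mathbb{E}[Y]$ and $\mathbb{E}[Y^2]_\infty=\lim_{N\to\infty}\mathbb{E}[Y^2]$. Then $$\lim_{p\to0}\frac{\mathbb{E}[Y^2]_\infty-\left(\mathbb{E}[Y]_\infty\right)^2}{\left(\mathbb{E}[Y]_\infty\right)^2}=0.$$
   Context: For a real number $0<p<1$ and an integer $N\ge 0$, let $A$ be a random subset of $\{0,\dots,N\}$ in which each integer in $\{0,\dots,N\}$ is included independently with probability $p$, and let $A+A=\{a+b : a,b\in A\}$ ($a=b$ allowed). Let $Y=|\{0\le n\le N : n\notin A+A\}|$ (a random variable depending on $p$ and $N$). *)

(* Defs.v *)
From mathcomp Require Import all_boot all_order all_algebra.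
From mathcomp Require Import all_classical all_reals all_analysis.
Set Implicit Arguments.
Unset Strict Implicit.
Unset Printing Implicit Defensive.
Import Order.TTheory GRing.Theory Num.Theory.
Import numFieldNormedType.Exports.
Local Open Scope ring_scope.

(* The law of the random subset A of {0, ..., N}: the N + 1 indicators of
   i \in A are independent Bernoulli variables of parameter p. *)
Definition subset_pmf (R : realType) (N : nat) (p : R)
    (A : {set 'I_N.+1}) : R :=
  \prod_(i < N.+1) bernoulli_pmf p (i \in A).

(* P(B \subset A) = p ^ #|B| for every B; B = set0 gives total mass 1. *)
Lemma subset_pmf_sup (R : realType) (N : nat) (p : R) (B : {set 'I_N.+1}) :
  \sum_(A : {set 'I_N.+1} | B \subset A) subset_pmf p A = p ^+ #|B|.
Proof.
transitivity (\prod_(i < N.+1) (p + (if i \in B then 0 else 1 - p))); last first.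
  rewrite (bigID (mem B)) /= [X in _ * X]big1 ?mulr1 => [|i /negPf ->]; last first.
    by rewrite addrC subrK.
  by under eq_bigr => i -> do rewrite addr0; rewrite prodr_const.
rewrite bigA_distr [RHS](bigID (fun A : {set _} => B \subset A)) /=.
rewrite [X in _ + X]big1 ?addr0 => [|A /fintype.subsetPn[i iB iA]]; last first.
  by rewrite (bigD1 i) //= (negPf iA) iB mul0r.
apply: eq_bigr => A /fintype.subsetP sBA; apply: eq_bigr => i _.
rewrite /bernoulli_pmf; case: ifPn => // iA.
by rewrite ifN //; apply: contra iA => /sBA.
Qed.

Definition expect (R : realType) (N : nat) (p : R)
    (X : {set 'I_N.+1} -> R) : R :=
  \sum_(A : {set 'I_N.+1}) subset_pmf p A * X A.

(* Sums are taken in nat: they may exceed N. *)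
Definition sumset (N : nat) (A : {set 'I_N.+1}) : seq nat :=
  [seq (nat_of_ord a + nat_of_ord b)%N | a <- enum A, b <- enum A].

Definition missing (N : nat) (A : {set 'I_N.+1}) : nat :=
  #|[set n : 'I_N.+1 | nat_of_ord n \notin sumset A]|.

Definition EY (R : realType) (p : R) (N : nat) : R :=
  expect p (fun A : {set 'I_N.+1} => (missing A)%:R).

Definition EY2 (R : realType) (p : R) (N : nat) : R :=
  expect p (fun A : {set 'I_N.+1} => (missing A)%:R ^+ 2).

(* [lim] is a total operator, meaningful only for convergent sequences. *)
Definition EY_oo (R : realType) (p : R) : R := limn (EY p).

Definition EY2_oo (R : realType) (p : R) : R := limn (EY2 p).

(* Main.v *)
Require Import Defs.
From mathcomp Require Import all_boot all_order all_algebra.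
From mathcomp Require Import all_classical all_reals all_analysis.
From mathcomp Require Import ring lra zify.
From mathcomp Require Import fintype finset.
Import Order.TTheory GRing.Theory Num.Theory.
Import numFieldNormedType.Exports.
Set Implicit Arguments.
Unset Strict Implicit.
Unset Printing Implicit Defensive.
Local Open Scope ring_scope.

(** Write [q = 1 - p] and call a set [e] avoided when it is not contained in
    the random set [A].  A number [m <= N] is missing from [A + A] exactly when
    every pair [{i, m - i}] is avoided, so each probability of interest is that
    of avoiding a family of small sets.  Such probabilities are estimated by
    adding the sets one at a time.  The probability lost with a new set [e] is
    that of [e] lying in [A] while the other sets are avoided, and:
    - it is at most [p ^+ #|e|] times the probability of avoiding the others,
      because avoidance is a decreasing event ([pavoid_cons_ge]);
    - it is at least [p ^+ #|e| * q ^+ #|S|] times that probability when [S] is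
      disjoint from [e] and every other set that meets [e] also meets [S]:
      forcing [e] into [A] and [S] out of [A] cannot destroy avoidance of the
      others ([pavoid_cons_le]).

    The pairs with sum [m] or [n] form a graph of maximal degree [2], so the
    second bound applies with [#|S| <= 2].  Hence, up to rounding, the
    probability that [m] is missing is at least
    [q * (1 - p ^+ 2) ^+ (m / 2)] ([pmissing_ge]), and the probability that
    [m != n] are both missing is at most
    [(1 - p ^+ 2 * q ^+ 2) ^+ (m / 2 + n / 2)] ([pmissing2_le]).

    Summing geometric series, the limit of the expectation is at least
    [2 * q / p ^+ 2] ([EY_oo_ge]), while the limit of the second moment is at
    most [(2 / (p ^+ 2 * q ^+ 2)) ^+ 2] plus a term of order [p ^- 2] coming
    from the diagonal [m = n] ([EY2_oo_le]).  The quotient of the second moment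
    by the squared expectation is therefore at most [1 + o(1)] as [p] tends to
    [0]; it is at least [1] because a variance is nonnegative ([EY_oo_sqr_le]).
    The limits exist because both moments are bounded and nondecreasing in [N]:
    restricting the random subset of [{0, ..., N + 1}] to [{0, ..., N}] gives
    the random subset of the latter, with no more missing numbers. *)

(** * Expectations over the random subset *)

Lemma eq_expect (R : realType) (N : nat) (p : R) (f g : {set 'I_N.+1} -> R) :
  f =1 g -> expect p f = expect p g.
Proof. by move=> fg; apply: eq_bigr => A _; rewrite fg. Qed.

Lemma subset_pmf_ge0 (R : realType) (N : nat) (p : R) (A : {set 'I_N.+1}) :
  0 <= p <= 1 -> 0 <= subset_pmf p A.
Proof.
case/andP=> p0 p1; apply: prodr_ge0 => i _.
by rewrite /bernoulli_pmf; case: ifP; rewrite ?subr_ge0.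
Qed.

Lemma le_expect (R : realType) (N : nat) (p : R) (f g : {set 'I_N.+1} -> R) :
  0 <= p <= 1 -> (forall A, f A <= g A) -> expect p f <= expect p g.
Proof.
move=> p01 fg; apply: ler_sum => A _.
by rewrite ler_wpM2l ?subset_pmf_ge0.
Qed.

Lemma expect_cst (R : realType) (N : nat) (p : R) (c : R) :
  expect p (fun _ : {set 'I_N.+1} => c) = c.
Proof.
rewrite /expect -mulr_suml (_ : \sum_A _ = 1) ?mul1r//.
rewrite -[RHS](expr0 p) -(cards0 'I_N.+1) -subset_pmf_sup.
by apply: eq_bigl => A; rewrite finset.sub0set.
Qed.

Lemma expectD (R : realType) (N : nat) (p : R) (f g : {set 'I_N.+1} -> R) :
  expect p (fun A => f A + g A) = expect p f + expect p g.
Proof. by rewrite /expect -big_split; apply: eq_bigr => A _; rewrite mulrDr. Qed.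

Lemma expectZ (R : realType) (N : nat) (p c : R) (f : {set 'I_N.+1} -> R) :
  expect p (fun A => c * f A) = c * expect p f.
Proof. by rewrite /expect mulr_sumr; apply: eq_bigr => A _; rewrite mulrCA. Qed.

Lemma expect_sum (R : realType) (N : nat) (p : R) (I : Type) (r : seq I)
    (f : I -> {set 'I_N.+1} -> R) :
  expect p (fun A => \sum_(i <- r) f i A) = \sum_(i <- r) expect p (f i).
Proof.
rewrite /expect exchange_big; apply: eq_bigr => A _; exact: mulr_sumr.
Qed.

(** Conditioning on whether the single element [x] is selected. *)
Lemma expect_cond (R : realType) (N : nat) (p : R) (x : 'I_N.+1)
    (f : {set 'I_N.+1} -> R) :
  expect p f = p * expect p (fun A => f (x |: A)) +
               (1 - p) * expect p (fun A => f (A :\ x)).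
Proof.
pose W (A : {set 'I_N.+1}) := \prod_(i < N.+1 | i != x) bernoulli_pmf p (i \in A).
(* Sets are grouped in pairs [A], [A :\ x] with [x] in [A]. *)
have splitE (g : {set 'I_N.+1} -> R) : expect p g =
    \sum_(A : {set 'I_N.+1} | x \in A) W A * (p * g A + (1 - p) * g (A :\ x)).
  rewrite /expect (bigID (fun A : {set 'I_N.+1} => x \in A)) /=.
  have -> : \sum_(A : {set 'I_N.+1} | x \notin A) subset_pmf p A * g A =
      \sum_(A : {set 'I_N.+1} | x \in A) (1 - p) * W A * g (A :\ x).
    rewrite [LHS](reindex_onto (fun A : {set 'I_N.+1} => A :\ x)
      (fun A => x |: A)); last first.
      by move=> A xA; rewrite setU1K.
    apply: eq_big => A /=.
      by rewrite setD11/=; apply/eqP/idP => [<-|xA]; rewrite ?setU11// setD1K.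
    rewrite setD11 /= => /eqP AE; congr (_ * _).
    rewrite /subset_pmf (bigD1 x)//= setD11; congr (_ * _).
    by apply: eq_bigr => i ix; rewrite in_setD1 ix.
  rewrite -big_split /=; apply: eq_bigr => A xA.
  by rewrite /subset_pmf (bigD1 x)//= xA -/(W A) /bernoulli_pmf; ring.
rewrite !splitE !mulr_sumr -big_split; apply: eq_bigr => A xA /=.
have -> : x |: A = A by apply/setUidPr; rewrite sub1set.
have -> : x |: (A :\ x) = A by rewrite setD1K.
have -> : (A :\ x) :\ x = A :\ x.
  by apply/setP => y; rewrite !inE; case: (y == x).
ring.
Qed.

Lemma expect_setU1 (R : realType) (N : nat) (p : R) (x : 'I_N.+1)
    (f : {set 'I_N.+1} -> R) :
  p * expect p (fun A => f (x |: A)) = expect p (fun A => (x \in A)%:R * f A).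
Proof.
rewrite [RHS](expect_cond p x).
rewrite [X in _ + _ * X](_ : _ = 0) ?mulr0 ?addr0; last first.
  by rewrite -(expect_cst N p 0); apply: eq_expect => A; rewrite setD11 mul0r.
by congr (_ * _); apply: eq_expect => A; rewrite setU11 mul1r.
Qed.

Lemma expect_setD1 (R : realType) (N : nat) (p : R) (x : 'I_N.+1)
    (f : {set 'I_N.+1} -> R) :
  (1 - p) * expect p (fun A => f (A :\ x)) =
  expect p (fun A => (x \notin A)%:R * f A).
Proof.
rewrite [RHS](expect_cond p x).
rewrite [X in _ * X + _](_ : _ = 0) ?mulr0 ?add0r; last first.
  by rewrite -(expect_cst N p 0); apply: eq_expect => A; rewrite setU11 mul0r.
by congr (_ * _); apply: eq_expect => A; rewrite setD11 mul1r.
Qed.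

(** Forcing [S] into the random subset amounts to conditioning on containing
    [S], by independence of the elements. *)
Lemma expect_setU (R : realType) (N : nat) (p : R) (S : {set 'I_N.+1})
    (f : {set 'I_N.+1} -> R) :
  p ^+ #|S| * expect p (fun A => f (S :|: A)) =
  expect p (fun A => (S \subset A)%:R * f A).
Proof.
have [n] := ubnP #|S|; elim: n S f => // n IHn S f.
have [->|[x xS]] := set_0Vmem S.
  move=> _; rewrite cards0 mul1r; apply: eq_expect => A.
  by rewrite set0U sub0set mul1r.
rewrite (cardsD1 x) xS ltnS => /= ltn; rewrite exprSr -mulrA.
transitivity (p ^+ #|S :\ x| * (p * expect p (fun A =>
    (fun B => f ((S :\ x) :|: B)) (x |: A)))).
  congr (_ * (_ * _)); apply: eq_expect => A /=.
  by rewrite setUA [_ :|: [set x]]setUC setD1K.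
rewrite (expect_setU1 p x (fun B => f ((S :\ x) :|: B))).
transitivity (p ^+ #|S :\ x| * expect p (fun A =>
    (fun B : {set 'I_N.+1} => (x \in B)%:R * f B) (S :\ x :|: A))).
  congr (_ * _); apply: eq_expect => A /=.
  by rewrite !inE eqxx.
rewrite (IHn _ (fun B : {set 'I_N.+1} => (x \in B)%:R * f B))//.
apply: eq_expect => A; rewrite mulrA -natrM mulnb andbC.
by rewrite -sub1set -subUset setD1K.
Qed.

Lemma expect_setD (R : realType) (N : nat) (p : R) (S : {set 'I_N.+1})
    (f : {set 'I_N.+1} -> R) :
  (1 - p) ^+ #|S| * expect p (fun A => f (A :\: S)) =
  expect p (fun A => [disjoint S & A]%:R * f A).
Proof.
have [n] := ubnP #|S|; elim: n S f => // n IHn S f.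
have [->|[x xS]] := set_0Vmem S.
  move=> _; rewrite cards0 mul1r; apply: eq_expect => A.
  by rewrite setD0 -setI_eq0 set0I eqxx mul1r.
rewrite (cardsD1 x) xS ltnS => /= ltn; rewrite exprSr -mulrA.
transitivity ((1 - p) ^+ #|S :\ x| * ((1 - p) * expect p (fun A =>
    (fun B => f (B :\: (S :\ x))) (A :\ x)))).
  congr (_ * (_ * _)); apply: eq_expect => A /=.
  by rewrite setDDl setD1K.
rewrite (expect_setD1 p x (fun B => f (B :\: (S :\ x)))).
transitivity ((1 - p) ^+ #|S :\ x| * expect p (fun A =>
    (fun B : {set 'I_N.+1} => (x \notin B)%:R * f B) (A :\: (S :\ x)))).
  congr (_ * _); apply: eq_expect => A /=.
  by rewrite !inE eqxx.
rewrite (IHn _ (fun B : {set 'I_N.+1} => (x \notin B)%:R * f B))//.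
apply: eq_expect => A; rewrite mulrA -natrM mulnb andbC.
by rewrite -[in RHS](setD1K xS) !disjoints_subset subUset sub1set inE.
Qed.

(** * The probability of avoiding a family of sets *)

Definition avoids (T : finType) (es : seq {set T}) (A : {set T}) : bool :=
  all (fun e : {set T} => ~~ (e \subset A)) es.

Lemma avoids_sub (T : finType) (es : seq {set T}) (A B : {set T}) :
  A \subset B -> avoids es B -> avoids es A.
Proof.
move=> AB /allP esB; apply/allP => e ees.
by apply: contra (esB _ ees) => /subset_trans; apply.
Qed.

Definition pavoid (R : realType) (N : nat) (p : R)
    (es : seq {set 'I_N.+1}) : R :=
  expect p (fun A => (avoids es A)%:R).

Lemma pavoid_ge0 (R : realType) (N : nat) (p : R) (es : seq {set 'I_N.+1}) :
  0 <= p <= 1 -> 0 <= pavoid p es.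
Proof. by move=> p01; rewrite -(expect_cst N p 0); exact: le_expect. Qed.

Lemma pavoid_cons (R : realType) (N : nat) (p : R) (e : {set 'I_N.+1})
    (es : seq {set 'I_N.+1}) :
  pavoid p (e :: es) =
  pavoid p es - expect p (fun A => (e \subset A)%:R * (avoids es A)%:R).
Proof.
apply/eqP; rewrite eq_sym subr_eq eq_sym -expectD; apply/eqP.
apply: eq_expect => A /=; rewrite /avoids /=.
by case: (e \subset A); rewrite /= ?mul1r ?mul0r ?addr0 ?add0r.
Qed.

(** The event that [e] lies in [A] and [es] is avoided is, up to the factor
    [p ^+ #|e|], the event that [es] is avoided after adding [e] to [A]. *)
Lemma pavoid_cons_ge (R : realType) (N : nat) (p : R) (e : {set 'I_N.+1})
    (es : seq {set 'I_N.+1}) :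
  0 <= p <= 1 -> (1 - p ^+ #|e|) * pavoid p es <= pavoid p (e :: es).
Proof.
move=> p01; rewrite pavoid_cons mulrBl mul1r lerD2l lerN2.
rewrite -(expect_setU _ _ (fun B => (avoids es B)%:R)).
rewrite ler_wpM2l ?exprn_ge0 ?(andP p01).1//.
apply: le_expect => // A; rewrite ler_nat.
by case: (boolP (avoids es (e :|: A))) => // /(avoids_sub (subsetUr e A)) ->.
Qed.

(** If [A] avoids [es] then so does [e :|: (A :\: S)]: a member of [es]
    contained in it is disjoint from [S], hence from [e], hence is contained in
    [A].  By independence, resampling [A] on [e] and [S] to this pattern costs
    the factor [p ^+ #|e| * (1 - p) ^+ #|S|]. *)
Lemma pavoid_cons_le (R : realType) (N : nat) (p : R) (e S : {set 'I_N.+1})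
    (es : seq {set 'I_N.+1}) :
  0 <= p <= 1 -> [disjoint e & S] ->
  (forall f, f \in es -> ~~ [disjoint f & e] -> ~~ [disjoint f & S]) ->
  pavoid p (e :: es) <= (1 - p ^+ #|e| * (1 - p) ^+ #|S|) * pavoid p es.
Proof.
move=> p01 deS nbr; have [p0 p1] := andP p01.
rewrite pavoid_cons mulrBl mul1r lerD2l lerN2.
apply: (@le_trans _ _ (expect p (fun A : {set 'I_N.+1} =>
    (e \subset A)%:R * ([disjoint S & A]%:R * (avoids es A)%:R)))); last first.
  apply: le_expect => // A; rewrite ler_wpM2l//.
  by case: [disjoint _ & _]; rewrite ?mul1r ?mul0r.
rewrite -(expect_setU _ _ (fun A => [disjoint S & A]%:R * (avoids es A)%:R)).
rewrite -mulrA ler_wpM2l ?exprn_ge0//.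
apply: (@le_trans _ _ ((1 - p) ^+ #|S| * expect p (fun A =>
    (fun B => (avoids es (e :|: B))%:R) (A :\: S)))).
  rewrite ler_wpM2l ?exprn_ge0 ?subr_ge0//.
  apply: le_expect => // A /=; rewrite ler_nat.
  case: (boolP (avoids es A)) => // /allP avA.
  suff -> : avoids es (e :|: (A :\: S)) by [].
  apply/allP => f fes; apply: contra (avA _ fes) => /subsetP sf.
  have dfS : [disjoint f & S].
    apply/pred0P => y /=; apply/negP => /andP[yf yS].
    have := sf _ yf; rewrite !inE yS orbF => ye.
    by have /pred0P/(_ y)/= := deS; rewrite ye yS.
  have dfe : [disjoint f & e] by apply: contraLR dfS => /(nbr _ fes).
  apply/subsetP => y yf; have := sf _ yf; rewrite !inE.
  case/orP => [ye|/andP[]//].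
  by have /pred0P/(_ y)/= := dfe; rewrite ye yf.
rewrite (expect_setD _ _ (fun B => (avoids es (e :|: B))%:R)); apply: le_expect => // A.
rewrite ler_wpM2r// ler_nat.
have -> // : [disjoint S & A] = [disjoint S & e :|: A].
rewrite ![[disjoint S & _]]disjoint_sym !disjoints_subset subUset.
by rewrite -(disjoints_subset e) deS.
Qed.

(** Harris' inequality for the decreasing events of avoiding each [e]. *)
Lemma pavoid_ge (R : realType) (N : nat) (p : R) (es : seq {set 'I_N.+1}) :
  0 <= p <= 1 -> \prod_(e <- es) (1 - p ^+ #|e|) <= pavoid p es.
Proof.
move=> p01; elim: es => [|e es IH]; first by rewrite big_nil /pavoid expect_cst.
rewrite big_cons; apply: le_trans (pavoid_cons_ge e es p01).
by rewrite ler_wpM2l// subr_ge0 exprn_ile1//; case/andP: p01.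
Qed.

(** A Janson-type bound for graphs of maximal degree [2]: the set [S] contains
    the neighbours of the edge [e]. *)
Lemma pavoid_le (R : realType) (N : nat) (p : R) (es : seq {set 'I_N.+1}) :
  0 <= p <= 1 -> uniq es -> {in es, forall e : {set 'I_N.+1}, #|e| = 2%N} ->
  {in es, forall e : {set 'I_N.+1}, exists S : {set 'I_N.+1},
    [/\ (#|S| <= 2)%N, [disjoint e & S] &
        {in es, forall f : {set 'I_N.+1}, f != e ->
           ~~ [disjoint f & e] -> ~~ [disjoint f & S]}]} ->
  pavoid p es <= (1 - p ^+ 2 * (1 - p) ^+ 2) ^+ size es.
Proof.
move=> p01; have [p0 p1] := andP p01.
elim: es => [|e es IH] ues ces nbr; first by rewrite /pavoid expect_cst.
have [S [cS deS nS]] := nbr e (mem_head _ _).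
have enotin : e \notin es by case/andP: ues.
apply: le_trans (pavoid_cons_le p01 deS _) _ => [f fes|].
  apply: nS; first by rewrite in_cons fes orbT.
  by apply: contraNneq enotin => <-.
rewrite ces ?mem_head// [leRHS]exprS ler_pM ?pavoid_ge0//.
- rewrite subr_ge0 mulr_ile1 ?exprn_ge0 ?exprn_ile1 ?subr_ge0//.
  by rewrite lerBlDr lerDl.
- rewrite lerD2l lerN2 ler_wpM2l ?exprn_ge0//.
  by rewrite ler_wiXn2l ?subr_ge0// lerBlDr lerDl.
apply: IH; first by case/andP: ues.
  by move=> f fes; apply: ces; rewrite in_cons fes orbT.
move=> f fes; have [|T [cT dfT nT]] := nbr f; first by rewrite in_cons fes orbT.
by exists T; split=> // g ges; apply: nT; rewrite in_cons ges orbT.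
Qed.

(** * Missing sums as avoided edges *)

Definition edge (N m i : nat) : {set 'I_N.+1} := [set inord i; inord (m - i)].

Lemma in_edge (N m i : nat) (x : 'I_N.+1) : (i <= m <= N)%N ->
  (x \in edge N m i) = (val x == i) || (val x == m - i)%N.
Proof.
by move=> imN; rewrite !inE -!val_eqE /= !inordK//; lia.
Qed.

Lemma card_edge (N m i : nat) : (m <= N)%N -> (i < m./2)%N -> #|edge N m i| = 2%N.
Proof.
move=> mN im; rewrite cards2 -val_eqE /= !inordK; [|lia|lia].
by have -> : (i != m - i)%N by lia.
Qed.

(** Pairs [{i, m - i}] need only be tested up to the middle one. *)
Lemma notin_sumset (N m : nat) (A : {set 'I_N.+1}) : (m <= N)%N ->
  (m \notin sumset A) = avoids [seq edge N m i | i <- iota 0 m./2.+1] A.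
Proof.
move=> mN; rewrite -[RHS]negbK; congr negb; rewrite /avoids -has_predC has_map.
apply/allpairsP/hasP => [[[a b] /= [aA bA mab]]|[i]].
  rewrite !mem_enum in aA bA.
  wlog ab : a b aA bA mab / (a <= b)%N.
    move=> H; case: (leqP a b) => [ab|/ltnW ba]; first exact: (H a b).
    by apply: (H b a) => //; rewrite addnC.
  exists (val a).
    by rewrite -[_ :: _]/(iota 0 m./2.+1) mem_iota /=; lia.
  rewrite /= negbK; apply/fintype.subsetP => x; rewrite in_edge; last by lia.
  case/orP => /eqP xE; first by rewrite (_ : x = a)//; exact: val_inj.
  by rewrite (_ : x = b)//; apply: val_inj; rewrite /= xE mab; lia.
rewrite mem_iota /= negbK => im /fintype.subsetP eA.
exists (inord i, inord (m - i)) => /=; rewrite !mem_enum.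
split; [by apply: eA; rewrite !inE eqxx|by apply: eA; rewrite !inE eqxx orbT|].
by rewrite !inordK; lia.
Qed.

(** The bound [m./2] excludes the middle element [i = m - i] of an even [m], so
    that these are genuine pairs; for odd [m] it also leaves out the middle
    pair. *)
Definition half_edges (N m : nat) := [seq edge N m i | i <- iota 0 m./2].

Lemma half_edgesP (N m : nat) (e : {set 'I_N.+1}) :
  reflect (exists2 i, (i < m./2)%N & e = edge N m i) (e \in half_edges N m).
Proof.
apply: (iffP mapP) => -[i]; first by rewrite mem_iota => im ->; exists i.
by move=> im ->; exists i; rewrite // mem_iota.
Qed.

Lemma edge_inj (N m n i j : nat) : (m <= N)%N -> (n <= N)%N ->
  (i < m./2)%N -> (j < n./2)%N -> edge N m i = edge N n j -> m = n /\ i = j.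
Proof.
move=> mN nN im jn E.
have /orP H1 : (val (inord i : 'I_N.+1) == j) ||
    (val (inord i : 'I_N.+1) == n - j)%N.
  by rewrite -in_edge -?E ?inE ?eqxx//; lia.
have /orP H2 : (val (inord (m - i) : 'I_N.+1) == j) ||
    (val (inord (m - i) : 'I_N.+1) == n - j)%N.
  by rewrite -in_edge -?E ?inE ?eqxx ?orbT//; lia.
have /orP H3 : (val (inord j : 'I_N.+1) == i) ||
    (val (inord j : 'I_N.+1) == m - i)%N.
  by rewrite -in_edge ?E ?inE ?eqxx//; lia.
by move: H1 H2 H3 => /=; rewrite !inordK; lia.
Qed.

Lemma half_edges_uniq (N m : nat) : (m <= N)%N -> uniq (half_edges N m).
Proof.
move=> mN; rewrite map_inj_in_uniq ?iota_uniq// => i j.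
by rewrite !mem_iota => im jm /edge_inj[].
Qed.

(** An edge of sum [m] is disjoint from the others of sum [m], and it meets the
    edges of sum [n] through its two reflections by [x |-> n - x]. *)
Lemma half_edges_nbr (N m n : nat) (e : {set 'I_N.+1}) :
  (m <= N)%N -> (n <= N)%N -> m != n -> e \in half_edges N m ->
  exists S : {set 'I_N.+1}, [/\ (#|S| <= 2)%N, [disjoint e & S]
    & {in half_edges N m ++ half_edges N n, forall f : {set 'I_N.+1}, f != e ->
       ~~ [disjoint f & e] -> ~~ [disjoint f & S]}].
Proof.
move=> mN nN mn /half_edgesP[i im ->].
exists ([set inord (n - i); inord (n - (m - i))] :\: edge N m i); split.
- apply: leq_trans (subset_leq_card (subsetDl _ _)) _.
  by rewrite cards2; case: (_ != _).
- rewrite disjoint_sym disjoints_subset; apply/fintype.subsetP => x.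
  by rewrite !inE => /andP[].
move=> f; rewrite mem_cat.
case/orP => /half_edgesP[j jm ->] fe /pred0Pn[x /= /andP[]].
  rewrite !in_edge; [|lia|lia] => H1 H2.
  have ij : i = j by lia.
  by rewrite ij eqxx in fe.
rewrite !in_edge; [|lia|lia] => /= H1 H2.
apply/pred0Pn; exists (inord (n - x)); rewrite /= in_setD.
rewrite !in_edge; [|lia|lia]; rewrite /= inordK; last by lia.
apply/and3P; split; [lia|lia|].
by rewrite !inE; case/orP: H2 => /eqP ->; rewrite eqxx ?orbT.
Qed.

Lemma pavoid_half_edges (R : realType) (N m n : nat) (p : R) :
  0 <= p <= 1 -> (m <= N)%N -> (n <= N)%N -> m != n ->
  pavoid p (half_edges N m ++ half_edges N n) <=
  (1 - p ^+ 2 * (1 - p) ^+ 2) ^+ (m./2 + n./2).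
Proof.
move=> p01 mN nN mn.
have -> : (m./2 + n./2)%N = size (half_edges N m ++ half_edges N n).
  by rewrite size_cat !size_map !size_iota.
apply: pavoid_le => // [|e|e].
- rewrite cat_uniq !half_edges_uniq// andbT /=.
  apply/hasPn => e /half_edgesP[j jn ->]; apply/negP => /half_edgesP[i im].
  by case/edge_inj => // nm; rewrite nm eqxx in mn.
- by rewrite mem_cat => /orP[] /half_edgesP[i im ->]; exact: card_edge.
rewrite mem_cat => /orP[eN|eN]; first exact: half_edges_nbr.
have [|S [cS dS nS]] := half_edges_nbr nN mN _ eN; first by rewrite eq_sym.
by exists S; split=> // f; rewrite mem_cat orbC -mem_cat => /nS.
Qed.

Definition pmissing (R : realType) (N : nat) (p : R) (m : nat) : R :=
  expect p (fun A : {set 'I_N.+1} => (m \notin sumset A)%:R).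

Definition pmissing2 (R : realType) (N : nat) (p : R) (m n : nat) : R :=
  expect p (fun A : {set 'I_N.+1} =>
    ((m \notin sumset A) && (n \notin sumset A))%:R).

Lemma notin_half_edges (N m : nat) (A : {set 'I_N.+1}) : (m <= N)%N ->
  m \notin sumset A -> avoids (half_edges N m) A.
Proof.
move=> mN; rewrite notin_sumset// -[X in iota 0 X]addn1 iotaD map_cat /avoids all_cat.
by case/andP.
Qed.

(** Independence would give a product of powers of [1 - p ^+ 2]; the dependence
    between the two events only costs the factor [(1 - p) ^+ 2] in the rate. *)
Lemma pmissing2_le (R : realType) (N m n : nat) (p : R) :
  0 <= p <= 1 -> (m <= N)%N -> (n <= N)%N -> m != n ->
  pmissing2 N p m n <= (1 - p ^+ 2 * (1 - p) ^+ 2) ^+ (m./2 + n./2).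
Proof.
move=> p01 mN nN mn; apply: le_trans (pavoid_half_edges p01 mN nN mn).
apply: le_expect => // A; rewrite ler_nat.
case: (boolP (_ && _)) => // /andP[mA nA].
by rewrite /avoids all_cat -!/(avoids _ _) !notin_half_edges.
Qed.

Lemma pmissing_le (R : realType) (N m : nat) (p : R) :
  0 <= p <= 1 -> (m <= N)%N ->
  pmissing N p m <= (1 - p ^+ 2 * (1 - p) ^+ 2) ^+ m./2.
Proof.
move=> p01 mN; have [->|m0] := eqVneq m 0%N.
  rewrite expr0 -(expect_cst N p 1); apply: le_expect => // A.
  by case: (_ \notin _); rewrite ?ler01.
rewrite -[m./2]addn0; apply: le_trans (pavoid_half_edges p01 mN (leq0n N) m0).
apply: le_expect => // A; rewrite cats0 ler_nat.
by case: (boolP (m \notin _)) => // /(notin_half_edges mN) ->.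
Qed.

(** The factor [1 - p] accounts for the middle set, which has one or two
    elements according to the parity of [m]. *)
Lemma pmissing_ge (R : realType) (N m : nat) (p : R) :
  0 <= p <= 1 -> (m <= N)%N ->
  (1 - p) * (1 - p ^+ 2) ^+ m./2 <= pmissing N p m.
Proof.
move=> p01 mN; have [p0 p1] := andP p01.
have -> : pmissing N p m = pavoid p [seq edge N m i | i <- iota 0 m./2.+1].
  by apply: eq_expect => A; rewrite notin_sumset.
apply: le_trans (pavoid_ge _ p01).
rewrite -[X in iota 0 X]addn1 iotaD map_cat big_cat big_seq1 /= mulrC.
rewrite ler_pM ?subr_ge0 ?exprn_ge0 ?subr_ge0 ?exprn_ile1//.
- rewrite big_map big_seq.
  rewrite (eq_bigr (fun=> 1 - p ^+ 2)); last first.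
    by move=> i; rewrite mem_iota => im; rewrite card_edge.
  by rewrite -big_seq big_const_seq count_predT size_iota iter_mulr_1.
rewrite lerD2l lerN2 -[leRHS]expr1 ler_wiXn2l//.
by rewrite card_gt0; apply/set0Pn; exists (inord (0 + m./2)); rewrite !inE eqxx.
Qed.

(** * Geometric sums *)

Lemma sum_half (R : pzRingType) (x : R) (K : nat) :
  \sum_(m < K.*2) x ^+ m./2 = 2 * \sum_(k < K) x ^+ k.
Proof.
elim: K => [|K IH]; first by rewrite !big_ord0 mulr0.
rewrite doubleS !big_ord_recr /= IH uphalf_double doubleK mulrDr -addrA.
by rewrite [2 * x ^+ K]mulr_natl mulr2n.
Qed.

Lemma geometric_sum (R : fieldType) (x : R) (K : nat) : x != 1 ->
  \sum_(k < K) x ^+ k = (1 - x ^+ K) / (1 - x).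
Proof.
move=> x1; have x10 : 1 - x != 0 by rewrite subr_eq0 eq_sym.
by rewrite -opprB subrX1 -mulNr opprB mulrAC divff ?mul1r.
Qed.

Lemma sum_half_le (R : realFieldType) (x : R) (n : nat) : 0 <= x < 1 ->
  \sum_(m < n) x ^+ m./2 <= 2 / (1 - x).
Proof.
case/andP=> x0 x1; have x10 : 0 < 1 - x by rewrite subr_gt0.
apply: (@le_trans _ _ (\sum_(m < n.*2) x ^+ m./2)).
  rewrite -addnn big_split_ord /= lerDl sumr_ge0// => i _; exact: exprn_ge0.
rewrite sum_half geometric_sum ?lt_eqF// ler_wpM2l//.
rewrite -[leRHS]mul1r ler_wpM2r ?invr_ge0 ?(ltW x10)//.
by rewrite gerBl exprn_ge0.
Qed.

(** * Monotonicity in the size of the ambient interval *)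

Definition trace (N : nat) (A : {set 'I_N.+2}) : {set 'I_N.+1} :=
  [set i | lift ord_max i \in A].

Definition untrace (N : nat) (b : bool) (B : {set 'I_N.+1}) : {set 'I_N.+2} :=
  [set i | if unlift ord_max i is Some j then j \in B else b].

Lemma untraceK (N : nat) (b : bool) (B : {set 'I_N.+1}) :
  trace (untrace b B) = B.
Proof. by apply/setP => i; rewrite !inE liftK. Qed.

Lemma traceK (N : nat) (A : {set 'I_N.+2}) :
  untrace (ord_max \in A) (trace A) = A.
Proof. by apply/setP => i; rewrite !inE; case: unliftP => [j|] ->; rewrite ?inE. Qed.

Lemma subset_pmf_untrace (R : realType) (N : nat) (p : R) (b : bool)
    (B : {set 'I_N.+1}) :
  subset_pmf p (untrace b B) = bernoulli_pmf p b * subset_pmf p B.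
Proof.
rewrite /subset_pmf (bigD1_ord ord_max)//= !inE unlift_none; congr (_ * _).
by apply: eq_bigr => i _; rewrite !inE liftK.
Qed.

(** The bit recording whether the largest element is selected is independent of
    the trace, and summing over it gives total mass [1]. *)
Lemma expect_trace (R : realType) (N : nat) (p : R) (f : {set 'I_N.+1} -> R) :
  expect p (fun A : {set 'I_N.+2} => f (trace A)) = expect p f.
Proof.
rewrite /expect (reindex (fun bB : bool * {set 'I_N.+1} => untrace bB.1 bB.2)) /=.
  rewrite -(pair_bigA _ (fun b B =>
    subset_pmf p (untrace b B) * f (trace (untrace b B)))) big_bool /= -big_split.
  apply: eq_bigr => B _; rewrite !untraceK !subset_pmf_untrace.
  by rewrite /= /bernoulli_pmf; ring.
exists (fun A : {set 'I_N.+2} => (ord_max \in A, trace A)) => [[b B] _|A _] /=.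
  by rewrite untraceK inE unlift_none.
exact: traceK.
Qed.

(** The summands of [n <= N] are at most [N], so they survive in the trace. *)
Lemma sumset_trace (N : nat) (A : {set 'I_N.+2}) (n : nat) : (n <= N)%N ->
  n \in sumset A -> n \in sumset (trace A).
Proof.
move=> nN /allpairsP[[a b] /= [aA bA nab]]; rewrite !mem_enum in aA bA.
move: aA nab; case: (unliftP ord_max a) => [a' ->|->]; last by rewrite /=; lia.
move: bA; case: (unliftP ord_max b) => [b' ->|->]; last by rewrite /=; lia.
rewrite !lift_max => bA aA ->; apply/allpairsP; exists (a', b').
by rewrite /= !mem_enum !inE.
Qed.

Lemma missing_trace (N : nat) (A : {set 'I_N.+2}) :
  (missing (trace A) <= missing A)%N.
Proof.
rewrite /missing -(card_imset _ (@lift_inj _ ord_max)) subset_leq_card//.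
apply/fintype.subsetP => _ /imsetP[n + ->]; rewrite !inE lift_max.
by apply: contra; apply: sumset_trace; rewrite -ltnS.
Qed.

Lemma EY_nondecreasing (R : realType) (p : R) : 0 <= p <= 1 ->
  {homo EY p : m n / (m <= n)%N >-> m <= n}.
Proof.
move=> p01; apply/nondecreasing_seqP => N; rewrite /EY -expect_trace.
by apply: le_expect => // A; rewrite ler_nat missing_trace.
Qed.

Lemma EY2_nondecreasing (R : realType) (p : R) : 0 <= p <= 1 ->
  {homo EY2 p : m n / (m <= n)%N >-> m <= n}.
Proof.
move=> p01; apply/nondecreasing_seqP => N; rewrite /EY2.
rewrite -(expect_trace p (fun A => (missing A)%:R ^+ 2)).
by apply: le_expect => // A; rewrite -!natrX ler_nat leq_sqr missing_trace.
Qed.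

(** * First and second moments *)

Lemma missingE (R : realType) (N : nat) (A : {set 'I_N.+1}) :
  (missing A)%:R = \sum_(m < N.+1) (val m \notin sumset A)%:R :> R.
Proof.
rewrite /missing -sum1_card natr_sum big_mkcond; apply: eq_bigr => i _.
by rewrite inE; case: (_ \notin _).
Qed.

Lemma EYE (R : realType) (p : R) (N : nat) :
  EY p N = \sum_(m < N.+1) pmissing N p m.
Proof.
by rewrite /EY -expect_sum; apply: eq_expect => A; rewrite missingE.
Qed.

Lemma EY2E (R : realType) (p : R) (N : nat) :
  EY2 p N = \sum_(m < N.+1) \sum_(n < N.+1) pmissing2 N p m n.
Proof.
rewrite /EY2; under [RHS]eq_bigr do rewrite -expect_sum.
rewrite -expect_sum; apply: eq_expect => A.
rewrite missingE expr2 mulr_suml; apply: eq_bigr => m _.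
by rewrite mulr_sumr; apply: eq_bigr => n _; rewrite -natrM mulnb.
Qed.

(** The difference of the two sides is the variance. *)
Lemma EY_sqr_le (R : realType) (p : R) (N : nat) : 0 <= p <= 1 ->
  EY p N ^+ 2 <= EY2 p N.
Proof.
move=> p01; rewrite -subr_ge0; set c := EY p N.
suff -> : EY2 p N - c ^+ 2 =
    expect p (fun A : {set 'I_N.+1} => ((missing A)%:R - c) ^+ 2).
  rewrite -(expect_cst N p 0); apply: le_expect => // A; exact: sqr_ge0.
transitivity (expect p (fun A : {set 'I_N.+1} =>
    (missing A)%:R ^+ 2 + (- (2 * c) * (missing A)%:R + c ^+ 2))).
  by rewrite !expectD expectZ expect_cst -/(EY2 p N) -/(EY p N) -/c; ring.
by apply: eq_expect => A; ring.
Qed.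

Lemma rate_itv (R : realType) (p : R) : 0 < p < 1 ->
  0 <= 1 - p ^+ 2 * (1 - p) ^+ 2 < 1.
Proof.
case/andP=> p0 p1.
rewrite subr_ge0 gtrBl mulr_gt0 ?exprn_gt0 ?subr_gt0// andbT.
by rewrite mulr_ile1 ?exprn_ge0 ?exprn_ile1 ?subr_ge0 ?ltW// gtrBl.
Qed.

Lemma EY_le (R : realType) (p : R) (N : nat) : 0 < p < 1 ->
  EY p N <= 2 / (p ^+ 2 * (1 - p) ^+ 2).
Proof.
move=> p01; have [p0 p1] := andP p01.
have p01' : 0 <= p <= 1 by rewrite !ltW.
pose r : R := 1 - p ^+ 2 * (1 - p) ^+ 2.
have -> : p ^+ 2 * (1 - p) ^+ 2 = 1 - r by rewrite /r; ring.
apply: le_trans (sum_half_le N.+1 _).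
  by rewrite EYE; apply: ler_sum => m _; rewrite pmissing_le// -ltnS.
exact: rate_itv.
Qed.

(** The diagonal terms contribute the expectation, of lower order. *)
Lemma EY2_le (R : realType) (p : R) (N : nat) : 0 < p < 1 ->
  EY2 p N <= (2 / (p ^+ 2 * (1 - p) ^+ 2)) ^+ 2 + 2 / (p ^+ 2 * (1 - p) ^+ 2).
Proof.
move=> p01; have [p0 p1] := andP p01.
have p01' : 0 <= p <= 1 by rewrite !ltW.
apply: le_trans (lerD (lexx _) (EY_le N p01)).
pose r : R := 1 - p ^+ 2 * (1 - p) ^+ 2.
have rE : p ^+ 2 * (1 - p) ^+ 2 = 1 - r by rewrite /r; ring.
have r01 : 0 <= r < 1 by exact: rate_itv.
have [r0 _] := andP r01.
rewrite rE; apply: le_trans (_ : (\sum_(m < N.+1) r ^+ m./2) ^+ 2 + EY p N <= _).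
  rewrite EY2E EYE expr2 mulr_suml -big_split; apply: ler_sum => m _ /=.
  rewrite mulr_sumr (bigD1 m)//= [X in _ <= X + _](bigD1 m)//=.
  rewrite addrAC lerD//.
    rewrite -[leLHS]add0r lerD// ?mulr_ge0 ?exprn_ge0//.
    by apply: le_expect => // A; rewrite andbb.
  by apply: ler_sum => n nm; rewrite -exprD pmissing2_le 1?eq_sym// -ltnS.
rewrite lerD2r lerXn2r ?nnegrE ?sum_half_le ?sumr_ge0// => [i _|].
  exact: exprn_ge0.
by rewrite divr_ge0 ?subr_ge0 ?ltW//; case/andP: r01.
Qed.

Lemma EY_ge (R : realType) (p : R) (K : nat) : 0 < p < 1 ->
  2 * (1 - p) / p ^+ 2 * (1 - (1 - p ^+ 2) ^+ K.+1) <= EY p K.*2.+1.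
Proof.
move=> p01; have [p0 p1] := andP p01.
have p01' : 0 <= p <= 1 by rewrite !ltW.
rewrite EYE.
apply: (@le_trans _ _ (\sum_(m < K.*2.+2) (1 - p) * (1 - p ^+ 2) ^+ m./2)).
  rewrite -mulr_sumr -doubleS sum_half geometric_sum; last first.
    by rewrite lt_eqF// gtrBl exprn_gt0.
  have p2 : p != 0 by rewrite gt_eqF.
  by rewrite subKr le_eqVlt; apply/predU1P; left; field.
by apply: ler_sum => m _; rewrite pmissing_ge// -ltnS.
Qed.

(** * Limits *)

Lemma is_cvg_EY (R : realType) (p : R) : 0 < p < 1 -> cvgn (EY p).
Proof.
move=> p01; apply: nondecreasing_is_cvgn.
  by apply: EY_nondecreasing; case/andP: p01 => p0 p1; rewrite !ltW.
by exists (2 / (p ^+ 2 * (1 - p) ^+ 2)) => _ [N _ <-]; exact: EY_le.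
Qed.

Lemma is_cvg_EY2 (R : realType) (p : R) : 0 < p < 1 -> cvgn (EY2 p).
Proof.
move=> p01; apply: nondecreasing_is_cvgn.
  by apply: EY2_nondecreasing; case/andP: p01 => p0 p1; rewrite !ltW.
exists ((2 / (p ^+ 2 * (1 - p) ^+ 2)) ^+ 2 + 2 / (p ^+ 2 * (1 - p) ^+ 2)).
by move=> _ [N _ <-]; exact: EY2_le.
Qed.

Lemma EY_oo_ge (R : realType) (p : R) : 0 < p < 1 ->
  2 * (1 - p) / p ^+ 2 <= EY_oo p.
Proof.
move=> p01; have [p0 p1] := andP p01.
pose u K : R := 2 * (1 - p) / p ^+ 2 * (1 - (1 - p ^+ 2) ^+ K.+1).
have s1 : `|1 - p ^+ 2| < 1.
  have p20 : 0 < p ^+ 2 by rewrite exprn_gt0.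
  have p21 : p ^+ 2 < 1 by rewrite expr_lt1// ltW.
  by rewrite ger0_norm; lra.
have cu : (u K @[K --> \oo] --> 2 * (1 - p) / p ^+ 2 * (1 - 0))%classic.
  apply: cvgMr; apply: cvgB; first exact: cvg_cst.
  by rewrite (cvg_shiftS (fun K => (1 - p ^+ 2) ^+ K)); exact: cvg_expr.
rewrite subr0 mulr1 in cu; rewrite -(cvg_lim _ cu)//.
apply: limr_le; first by apply/cvg_ex; exists (2 * (1 - p) / p ^+ 2).
apply: nearW => K; apply: le_trans (EY_ge K p01) _.
apply: nondecreasing_cvgn_le; last exact: is_cvg_EY.
by apply: EY_nondecreasing; rewrite !ltW.
Qed.

Lemma EY2_oo_le (R : realType) (p : R) : 0 < p < 1 ->
  EY2_oo p <=
    (2 / (p ^+ 2 * (1 - p) ^+ 2)) ^+ 2 + 2 / (p ^+ 2 * (1 - p) ^+ 2).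
Proof.
move=> p01; apply: limr_le; first exact: is_cvg_EY2.
by apply: nearW => N; exact: EY2_le.
Qed.

Lemma EY_oo_sqr_le (R : realType) (p : R) : 0 < p < 1 ->
  EY_oo p ^+ 2 <= EY2_oo p.
Proof.
move=> p01; have cE := is_cvg_EY p01.
have cE2 : ((EY p N) ^+ 2 @[N --> \oo] --> EY_oo p ^+ 2)%classic.
  by rewrite expr2; under eq_fun do rewrite expr2; exact: cvgM.
rewrite -(cvg_lim _ cE2)//; apply: ler_lim.
- by apply/cvg_ex; exists (EY_oo p ^+ 2).
- exact: is_cvg_EY2.
apply: nearW => N; apply: EY_sqr_le.
by case/andP: p01 => p0 p1; rewrite !ltW.
Qed.

(** The right-hand side is the quotient of the bound [EY2_oo_le] by the square
    of the bound [EY_oo_ge], minus [1]; it vanishes at [p = 0]. *)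
Lemma ratio_le (R : realType) (p : R) : 0 < p < 1 ->
  (EY2_oo p - EY_oo p ^+ 2) / EY_oo p ^+ 2 <=
  (1 - p)^-1 ^+ 6 + 2^-1 * p ^+ 2 * (1 - p)^-1 ^+ 4 - 1.
Proof.
move=> p01; have [p0 p1] := andP p01.
have q0 : 0 < 1 - p by rewrite subr_gt0.
have L0 : 0 < 2 * (1 - p) / p ^+ 2 by rewrite divr_gt0 ?exprn_gt0// mulr_gt0.
have E0 : 0 < EY_oo p := lt_le_trans L0 (EY_oo_ge p01).
rewrite mulrBl divff ?lt0r_neq0 ?exprn_gt0// lerD2r ler_pdivrMr ?exprn_gt0//.
apply: le_trans (EY2_oo_le p01) _.
have -> : (2 / (p ^+ 2 * (1 - p) ^+ 2)) ^+ 2 + 2 / (p ^+ 2 * (1 - p) ^+ 2) =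
    ((1 - p)^-1 ^+ 6 + 2^-1 * p ^+ 2 * (1 - p)^-1 ^+ 4) *
    (2 * (1 - p) / p ^+ 2) ^+ 2.
  by field; rewrite !lt0r_neq0.
rewrite ler_wpM2l//.
  by rewrite addr_ge0 ?mulr_ge0 ?exprn_ge0 ?invr_ge0 ?ltW.
by rewrite lerXn2r ?nnegrE ?EY_oo_ge// ltW.
Qed.

Local Open Scope classical_set_scope.

Theorem mainTheorem6 (R : realType) :
  (forall p : R, 0 < p < 1 ->
     [/\ cvgn (EY p), cvgn (EY2 p) & EY_oo p != 0]) /\
  (EY2_oo p - EY_oo p ^+ 2) / EY_oo p ^+ 2 @[p --> (0 : R)^'+] --> (0 : R).
Proof.
split=> [p p01|].
  have [p0 p1] := andP p01.
  split; [exact: is_cvg_EY|exact: is_cvg_EY2|rewrite lt0r_neq0//].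
  apply: lt_le_trans (EY_oo_ge p01).
  by rewrite divr_gt0 ?exprn_gt0// mulr_gt0// subr_gt0.
pose h (p : R) : R := (1 - p)^-1 ^+ 6 + 2^-1 * p ^+ 2 * (1 - p)^-1 ^+ 4 - 1.
have ch : h p @[p --> (0 : R)^'+] --> (0 : R).
  apply: cvg_at_right_filter.
  have h0 : h 0 = 0 by rewrite /h; field.
  rewrite -[X in _ --> X]h0.
  have cq : (1 - p)^-1 @[p --> (0 : R)] --> (1 - 0 : R)^-1.
    apply: cvgV; first by rewrite subr0 oner_neq0.
    by apply: cvgB; [exact: cvg_cst|exact: cvg_id].
  have cX n (f : R -> R) (l : R) : f p @[p --> (0 : R)] --> l ->
      f p ^+ n @[p --> (0 : R)] --> l ^+ n.
    by move=> fl; exact: cvg_comp fl (@exprn_continuous R n l).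
  apply: cvgB; last exact: cvg_cst.
  apply: cvgD; first exact: (cX 6%N _ _ cq).
  apply: cvgM; last exact: (cX 4%N _ _ cq).
  by apply: cvgMr; exact: (cX 2%N id _ cvg_id).
apply: (squeeze_cvgr _ (cvg_cst 0) ch).
near=> p.
have p01 : 0 < p < 1 by apply/andP; split.
rewrite ratio_le// andbT divr_ge0 ?exprn_even_ge0 ?subr_ge0//.
exact: EY_oo_sqr_le.
Unshelve. all: by end_near.
Qed.
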